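(* Let $(\underline F,\overline F)$ be a p-box on a totally preordered space $(\Omega,\preceq)$ with smallest element $0_\Omega$ and largest element $1_\Omega$. Then $(\underline F,\overline F)$ is maximum-preserving, i.e. $\overline E_{\underline F,\overline F}(A\cup B)=\max\{\overline E_{\underline F,\overline F}(A),\overline E_{\underline F,\overline F}(B)\}$ for all $A,B\subseteq\Omega$, if and only if $\underline F$ is $0$–$1$-valued or $\overline F$ is $0$–$1$-valued.
   Context: A total preorder $\preceq$ is reflexive, transitive, with any two elements comparable. A cumulative distribution function is a non-decreasing map $F:\Omega\to[0,1]$ with $F(1_\Omega)=1$ (no continuity is required). A p-box is a pair $(\underline F,\overline F)$ of cumulative distribution functions with $\underline F\le\overline F$. $F$ is $0$–$1$-valued if it takes only the values $0$ and $1$. The natural extension of the p-box is $\overline E_{\underline F,\overline F}(A)=\sup P(A)$ for $A\subseteq\Omega$, the supremum being over all finitely additive probabilities $P$ on the power set of $\Omega$ with $\underline F(x)\le P([0_\Omega,x])\le\overline F(x)$ for all $x\in\Omega$, where $[0_\Omega,x]=\{z\in\Omega: z\preceq x\}$. *)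

(* Defs.v *)
From mathcomp Require Export all_boot all_order all_algebra.
From mathcomp Require Export all_classical all_reals.

Set Implicit Arguments.
Unset Strict Implicit.
Unset Printing Implicit Defensive.

Import Order.TTheory GRing.Theory Num.Theory.
Local Open Scope classical_set_scope.
Local Open Scope ring_scope.

(* MathComp's [tbPreorderType] provides a bool-valued preorder with a chosen
   smallest element [\bot] and a chosen largest element [\top]; the relation
   need not be antisymmetric, so other elements may be equivalent to them.
   Totality is not part of the structure and is assumed where it is needed. *)

Definition is_cdf (R : realType) (d : Order.disp_t) (T : tbPreorderType d)
    (F : T -> R) : Prop :=
  [/\ {homo F : x y / (x <= y)%O >-> x <= y},
      forall x, 0 <= F x <= 1
    & F (\top)%O = 1].

Definition is_pbox (R : realType) (d : Order.disp_t) (T : tbPreorderType d)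
    (Fl Fu : T -> R) : Prop :=
  [/\ is_cdf Fl, is_cdf Fu & forall x, Fl x <= Fu x].

Definition zero_one_valued (R : realType) (T : Type) (F : T -> R) : Prop :=
  forall x, F x = 0 \/ F x = 1.

Definition finitely_additive_probability (R : realType) (T : Type)
    (P : set T -> R) : Prop :=
  [/\ forall A, 0 <= P A,
      P setT = 1
    & forall A B, A `&` B = set0 -> P (A `|` B) = P A + P B].

(* [0_Omega, x]; it contains every element equivalent to x. *)
Definition down_set (d : Order.disp_t) (T : tbPreorderType d) (x : T) : set T :=
  [set z | (z <= x)%O].

Definition credal_set (R : realType) (d : Order.disp_t) (T : tbPreorderType d)
    (Fl Fu : T -> R) : set (set T -> R) :=
  [set P | finitely_additive_probability P /\
           forall x, Fl x <= P (down_set x) <= Fu x].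

(* The supremum is over a set of reals bounded by 0 and 1, and this set is
   nonempty for a p-box on a total preorder, so the default value that [sup]
   takes on sets without a supremum plays no role. *)
Definition natural_extension (R : realType) (d : Order.disp_t)
    (T : tbPreorderType d) (Fl Fu : T -> R) (A : set T) : R :=
  sup [set P A | P in credal_set Fl Fu].

Definition maximum_preserving (R : realType) (T : Type)
    (E : set T -> R) : Prop :=
  forall A B, E (A `|` B) = Num.max (E A) (E B).

(* Main.v *)
(* Adjoin to [T] a point [None] below everything, with empty down-set and cdf
   value 0; the constraints on [P] become [lo i <= P (K i) <= hi i] along a chain
   of sets [K i] running from the empty set to the whole space.

   If [lo] is 0-1-valued, the constraints say that certain sets are null and that
   [P (K i) <= hi i]. Then the upper probability of [A] is the infimum of [hi i]
   over the [i] such that [K i] contains [A] up to a null set. These index sets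
   are upward closed in the chain, hence comparable for [A] and [B], and the one
   of the union is their intersection; so the upper probability is maxitive.
   The infimum is attained by a mixture of two ultrafilter probabilities. The
   case where [hi] is 0-1-valued follows by passing to complements.

   Conversely, if [0 < Fl x < 1] and [0 < Fu y < 1], maxitivity fails for
   [0, y] and the complement of [0, x]. *)
Require Import Defs.
From mathcomp Require Import lra all_analysis.

Set Implicit Arguments.
Unset Strict Implicit.
Unset Printing Implicit Defensive.

Import Order.TTheory GRing.Theory Num.Theory.
Import numFieldNormedType.Exports.
Local Open Scope classical_set_scope.
Local Open Scope ring_scope.

(** * Finitely additive probabilities and their 0-1-valued instances from ultrafilters *)

Lemma fap_setC (R : realType) (T : Type) (P : set T -> R) (A : set T) :
  finitely_additive_probability P -> P (~` A) = 1 - P A.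
Proof.
move=> [_ P1 PU]; rewrite -P1 -(setUv A) PU ?setICr //; lra.
Qed.

Lemma fap_le (R : realType) (T : Type) (P : set T -> R) (A B : set T) :
  finitely_additive_probability P -> A `<=` B -> P A <= P B.
Proof.
move=> [P0 _ PU] AB; rewrite -(setDUK AB) PU ?setIDK //; last first.
  by rewrite setDE setICA setICr setI0.
by rewrite lerDl.
Qed.

Lemma fap_set0 (R : realType) (T : Type) (P : set T -> R) :
  finitely_additive_probability P -> P set0 = 0.
Proof.
by move=> fP; rewrite -setCT (fap_setC _ fP); case: fP => _ -> _; lra.
Qed.

Lemma fap_le1 (R : realType) (T : Type) (P : set T -> R) (A : set T) :
  finitely_additive_probability P -> P A <= 1.
Proof. by move=> fP; case: (fP) => _ <- _; apply: fap_le. Qed.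

Lemma fap_setU_le (R : realType) (T : Type) (P : set T -> R) (A B : set T) :
  finitely_additive_probability P -> P (A `|` B) <= P A + P B.
Proof.
move=> fP; have -> : A `|` B = A `|` (B `\` A) by rewrite setDE setUIr setUv setIT.
have [_ _ ->] := fP; last by rewrite setDE setICA setICr setI0.
by rewrite lerD2l; apply: fap_le => // x [].
Qed.

Lemma fap_conv (R : realType) (T : Type) (P Q : set T -> R) (s : R) :
  0 <= s <= 1 ->
  finitely_additive_probability P -> finitely_additive_probability Q ->
  finitely_additive_probability (fun A => (1 - s) * P A + s * Q A).
Proof.
move=> /andP[s0 s1] [P0 P1 PU] [Q0 Q1 QU]; split=> [A||A B AB].
- by rewrite addr_ge0 // mulr_ge0 // subr_ge0.
- by rewrite P1 Q1; lra.
- by rewrite PU // QU //; lra.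
Qed.

Definition ultra_prob (R : realType) (T : Type) (G : set_system T)
    (A : set T) : R :=
  (`[< G A >])%:R.

Lemma ultra_probT (R : realType) (T : Type) (G : set_system T) (A : set T) :
  G A -> ultra_prob R G A = 1.
Proof. by move=> GA; rewrite /ultra_prob asboolT. Qed.

Lemma ultra_probF (R : realType) (T : Type) (G : set_system T) (A : set T) :
  ~ G A -> ultra_prob R G A = 0.
Proof. by move=> GA; rewrite /ultra_prob asboolF. Qed.

Lemma fap_ultra_prob (R : realType) (T : Type) (G : set_system T) :
  UltraFilter G -> finitely_additive_probability (@ultra_prob R T G).
Proof.
move=> GU; split=> [A||A B AB0]; first by rewrite ler0n.
  by rewrite ultra_probT //; exact: filterT.
have [GA|GCA] := in_ultra_setVsetC A GU.
  have GB : ~ G B.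
    move=> GB; apply: (@filter_not_empty _ G _); rewrite -AB0.
    exact: filterI.
  rewrite (ultra_probT _ GA) (ultra_probF _ GB) ultra_probT ?addr0 //.
  by apply: filterS GA; exact: subsetUl.
have GA : ~ G A.
  move=> GA; apply: (@filter_not_empty _ G _); rewrite -(setICr A).
  exact: filterI.
rewrite (ultra_probF _ GA) add0r /ultra_prob; congr (_%:R); congr nat_of_bool.
apply/asbool_equiv_eq; split=> [GAB|GB]; last by apply: filterS GB; exact: subsetUr.
by apply: filterS (filterI GCA GAB) => x [nA []].
Qed.

(** * Ultrafilters cutting a chain of sets *)

Definition set_chain (T I : Type) (K : I -> set T) : Prop :=
  forall i j, K i `<=` K j \/ K j `<=` K i.

Lemma set_chainC (T I : Type) (K : I -> set T) :
  set_chain K -> set_chain (fun i => ~` K i).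
Proof. by move=> Kc i j; case: (Kc i j) => /subsetC; [right|left]. Qed.

(** In a chain, the union or intersection of two members is one of the two, so the sets
    [(A]&[K j)]\[K i] are closed under intersection up to refinement. They are nonempty by
    hypothesis, and any ultrafilter refining the filter they generate will do. *)
Lemma ultrafilter_cut (T I : Type) (K : I -> set T) (C D : set I) (A : set T) :
  set_chain K -> C !=set0 -> D !=set0 ->
  (forall i j, C i -> D j -> ~ (A `&` K j `<=` K i)) ->
  exists G : set_system T, [/\ UltraFilter G, G A,
    forall j, D j -> G (K j) & forall i, C i -> ~ G (K i)].
Proof.
move=> Kc [i0 Ci0] [j0 Dj0] CD.
pose F := filter_from [set p : I * I | C p.1 /\ D p.2]
  (fun p => (A `&` K p.2) `\` K p.1).
have Kmax i j : C i -> C j -> exists2 k, C k & K i `|` K j `<=` K k.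
  move=> Ci Cj; case: (Kc i j) => [/setUidPr|/setUidPl] ->.
    by exists j.
  by exists i.
have Kmin i j : D i -> D j -> exists2 k, D k & K k `<=` K i `&` K j.
  move=> Di Dj; case: (Kc i j) => [/setIidPl|/setIidPr] ->.
    by exists i.
  by exists j.
have PF : ProperFilter F.
  apply: filter_from_proper.
    apply: filter_from_filter; first by exists (i0, j0).
    move=> [i j] [i' j'] /= [Ci Dj] [Ci' Dj'].
    have [k Ck kU] := Kmax _ _ Ci Ci'; have [l Dl lI] := Kmin _ _ Dj Dj'.
    exists (k, l) => //= x [[Ax /lI[jx j'x]] nk].
    by split; split=> // Kx; apply: nk; apply: kU; [left|right].
  move=> [i j] /= [Ci Dj]; apply/set0P/eqP.
  by rewrite setD_eq0; exact: CD.
have [G [GU FG]] := ultraFilterLemma PF.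
exists G; split=> //.
- by apply: FG; exists (i0, j0) => //= x [[]].
- by move=> j Dj; apply: FG; exists (i0, j) => //= x [[]].
- move=> i Ci GKi; apply: (@filter_not_empty _ G _).
  rewrite -(setICr (K i)); apply: filterI => //.
  by apply: FG; exists (i, j0) => //= x [].
Qed.

(** * Ultralimits and means of probabilities *)

Lemma ultra_fmap (T U : Type) (f : T -> U) (F : set_system T) :
  UltraFilter F -> UltraFilter (f @ F).
Proof.
move=> FU; split=> [|G GF FG]; first exact: fmap_proper_filter.
rewrite eqEsubset; split=> // S GS.
have [//|FC] := in_ultra_setVsetC (f @^-1` S) FU.
exfalso; apply: (@filter_not_empty _ G _); rewrite -(setICr S).
by apply: filterI => //; exact: FG.
Qed.

(** Take limits along an ultrafilter refining the eventual filter: they exist because [[0, 1]] is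
    compact, respect sums, and agree with ordinary limits where these exist. *)
Lemma fap_ultralimit (R : realType) (T : Type) (P_ : nat -> set T -> R) :
  (forall n, finitely_additive_probability (P_ n)) ->
  exists2 P, finitely_additive_probability P &
    forall A l, P_ n A @[n --> \oo] --> l -> P A = l.
Proof.
move=> fP.
have [W [WU ooW]] := ultraFilterLemma eventually_filter.
have cvgW A : exists l : R, P_ n A @[n --> W] --> l.
  have := @segment_compact R 0 1; rewrite compact_ultra.
  case/(_ _ (ultra_fmap (fun n => P_ n A) WU)) => [|l [_ Wl]]; last by exists l.
  apply: (@filterE _ W) => n; have [P0 _ _] := fP n.
  by rewrite /= in_itv /= P0 fap_le1.
have [P PE] := choice cvgW.
have Plim A l : P_ n A @[n --> W] --> l -> P A = l.
  exact: (cvg_unique (@norm_hausdorff _ R^o) (PE A)).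
exists P; last by move=> A l Al; apply: Plim; apply: cvg_trans Al; apply: cvg_app.
split=> [A||A B AB0].
- by apply: (cvgr_to_ge (PE A)); apply: filterE => n; have [] := fP n.
- apply: Plim; rewrite (_ : (fun n => P_ n setT) = cst 1); first exact: cvg_cst.
  by apply/funext => n; have [] := fP n.
- apply: Plim; rewrite (_ : (fun n => P_ n (A `|` B)) = P_ ^~ A \+ P_ ^~ B).
    exact: cvgD.
  by apply/funext => n; have [_ _ ->] := fP n.
Qed.

Lemma fap_mean (R : realType) (T : Type) (n : nat) (P_ : 'I_n.+1 -> set T -> R) :
  (forall k, finitely_additive_probability (P_ k)) ->
  finitely_additive_probability (fun A => (\sum_k P_ k A) / n.+1%:R).
Proof.
move=> fP; split=> [A||A B AB0].
- by rewrite divr_ge0 ?ler0n // sumr_ge0 // => k _; have [] := fP k.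
- rewrite (eq_bigr (fun=> 1)); last by move=> k _; have [] := fP k.
  by rewrite sumr_const card_ord divff // pnatr_eq0.
- rewrite -mulrDl -big_split /=; congr (_ / _); apply: eq_bigr => k _.
  by have [_ _ ->] := fP k.
Qed.

(** For [x <= 1] this is the fraction of the quantiles [1/n.+1, ..., n.+1/n.+1] that are at most
    [x]. *)
Lemma cvg_truncn_div (R : realType) (x : R) : 0 <= x ->
  (Num.truncn (n.+1%:R * x))%:R / n.+1%:R @[n --> \oo] --> x.
Proof.
move=> x0; apply: (@squeeze_cvgr _ _ _ _ (fun n => x - n.+1%:R^-1) (cst x)).
- apply: nearW => n; have n0 : 0 < n.+1%:R :> R by rewrite ltr0n.
  have /truncn_itv/andP[le lt] : 0 <= n.+1%:R * x by rewrite mulr_ge0 // ltW.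
  rewrite /= ler_pdivrMr // (mulrC x) le andbT ler_pdivlMr //.
  by rewrite mulrBl mulVf ?gt_eqF // lerBlDr mulrC natr1 ltW.
- rewrite -[X in _ --> X]subr0; apply: cvgB; first exact: cvg_cst.
  exact: cvg_harmonic.
- exact: cvg_cst.
Qed.

(** * The chain of down-sets and the extension of a cdf *)

Definition lower_set (d : Order.disp_t) (T : tbPreorderType d) : option T -> set T :=
  oapp (@down_set d T) set0.

Lemma lower_set_chain (d : Order.disp_t) (T : tbPreorderType d) :
  total (fun x y : T => (x <= y)%O) -> set_chain (@lower_set d T).
Proof.
move=> tot [x|] [y|]; [|by right|by left|by left].
by case/orP: (tot x y) => xy; [left|right] => z /= zx; exact: le_trans xy.
Qed.

Lemma cdf_lower_set_le (R : realType) (d : Order.disp_t) (T : tbPreorderType d)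
    (F : T -> R) (i j : option T) :
  is_cdf F -> lower_set i `<=` lower_set j -> oapp F 0 i <= oapp F 0 j.
Proof.
move=> [Fh F01 _]; case: i j => [x|] [y|] //= xy.
- by apply: Fh; apply: xy; exact: lexx.
- by case: (xy x); exact: lexx.
- by case/andP: (F01 y).
Qed.

(* Average the 0-1 probabilities of ultrafilters sitting at the quantiles
   [1/n, ..., n/n] of [F], then pass to an ultralimit in [n]. *)
Lemma cdf_extension (R : realType) (d : Order.disp_t) (T : tbPreorderType d)
    (F : T -> R) :
  total (fun x y : T => (x <= y)%O) -> is_cdf F ->
  exists2 P, finitely_additive_probability P &
    forall x, P (down_set x) = F x.
Proof.
move=> tot cF; have [_ F01 F1] := cF.
have quantile (u : R) : exists G : set_system T, 0 < u <= 1 ->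
    UltraFilter G /\ forall x, G (down_set x) <-> u <= F x.
  (* Outside [(0, 1]] nothing is claimed, and [setT] is a placeholder. *)
  have [/andP[u0 u1]|nu] := boolP (0 < u <= 1); last by exists setT.
  have [||i j /= iu uj|G [GU _ GD GC]] := @ultrafilter_cut T _ (@lower_set d T)
    [set i | oapp F 0 i < u] [set i | u <= oapp F 0 i] setT
    (lower_set_chain tot).
  - by exists None.
  - by exists (Some \top%O) => /=; rewrite F1.
  - rewrite setTI => /(cdf_lower_set_le cF).
    by rewrite leNgt (lt_le_trans iu uj).
  - exists G => _; split=> // x; split=> [Gx|]; last exact: (GD (Some x)).
    by rewrite leNgt; apply/negP => /(GC (Some x)); exact.
have [G GP] := choice quantile.
have fG n (k : 'I_n.+1) : 0 < (k.+1%:R / n.+1%:R : R) <= 1.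
  by rewrite divr_gt0 ?ltr0n //= ler_pdivrMr ?ltr0n // mul1r ler_nat.
have [|P fP Plim] := @fap_ultralimit R T (fun n A =>
  (\sum_(k < n.+1) ultra_prob R (G (k.+1%:R / n.+1%:R)) A) / n.+1%:R).
  move=> n; apply: fap_mean => k; apply: fap_ultra_prob.
  by have [] := GP _ (fG n k).
exists P => // x; apply: Plim.
have /andP[Fx0 Fx1] := F01 x.
rewrite (_ : (fun n => _) = fun n => (Num.truncn (n.+1%:R * F x))%:R / n.+1%:R).
  exact: cvg_truncn_div.
apply/funext => n; congr (_ / _).
have le_n : (Num.truncn (n.+1%:R * F x) <= n.+1)%N.
  by rewrite -[leqRHS](@natrK R) le_truncn // ler_piMr.
(* The ultrafilter at level [k.+1 / n.+1] contains [down_set x] iff [k.+1 <= n.+1 * F x], that is,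
   iff [k] is below the truncation. *)
transitivity (\sum_(k < n.+1 | (k < Num.truncn (n.+1%:R * F x))%N) (1 : R)).
  rewrite [RHS]big_mkcond; apply: eq_bigr => k _.
  rewrite truncn_gt_nat (mulrC _ (F x)) -ler_pdivrMr ?ltr0n //.
  have [_ /(_ x) [Gle leG]] := GP _ (fG n k).
  case: ifPn => [/leG|/negP nle]; first exact: ultra_probT.
  by rewrite ultra_probF // => /Gle.
by rewrite -(big_ord_widen _ (fun=> 1)) // sumr_const card_ord.
Qed.

(** * Maxitivity along a chain with a 0-1-valued lower bound *)

Definition between (R : realType) (T I : Type) (K : I -> set T) (lo hi : I -> R) :
    set (set T -> R) :=
  [set P | finitely_additive_probability P /\
           forall i, lo i <= P (K i) <= hi i].

(* [lo j = 1] forces [P] to vanish outside [K j]. *)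
Definition almost_contains (R : realType) (T I : Type) (K : I -> set T)
    (lo : I -> R) (A : set T) : set I :=
  [set i | exists2 j, lo j = 1 & A `&` K j `<=` K i].

Lemma almost_contains_le (R : realType) (T I : Type) (K : I -> set T)
    (lo hi : I -> R) (A B : set T) (P : set T -> R) (i : I) :
  between K lo hi P ->
  almost_contains K lo A i -> almost_contains K lo B i -> P (A `|` B) <= hi i.
Proof.
move=> [fP PK] [j j1 Aj] [k k1 Bk].
have null l : lo l = 1 -> P (~` K l) <= 0.
  by move=> l1; rewrite fap_setC // subr_le0 -l1; have /andP[] := PK l.
have /(fap_le fP) : A `|` B `<=` K i `|` (~` K j `|` ~` K k).
  move=> x [Ax|Bx].
    by have [/(conj Ax)/Aj|] := pselect (K j x); [left|right; left].
  by have [/(conj Bx)/Bk|] := pselect (K k x); [left|right; right].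
move/le_trans; apply; apply: le_trans (fap_setU_le _ _ fP) _.
have := fap_setU_le (~` K j) (~` K k) fP; have := null _ j1; have := null _ k1.
by have /andP[_] := PK i; lra.
Qed.

Lemma almost_contains_total (R : realType) (T I : Type) (K : I -> set T)
    (lo : I -> R) (A B : set T) :
  set_chain K ->
  almost_contains K lo A `<=` almost_contains K lo B \/
  almost_contains K lo B `<=` almost_contains K lo A.
Proof.
move=> Kc.
have [|nAB] := pselect (almost_contains K lo A `<=` almost_contains K lo B).
  by left.
move/existsNP: nAB => [i /not_implyP[Ai Bi]]; right=> j Bj.
have [k k1 Ak] := Ai; exists k => //; apply: subset_trans Ak _.
(* Were [K j] inside [K i], the witness for [j] and [B] would also serve [i], against the choice of
   [i]. *)
case: (Kc i j) => // ji; case: Bi; have [l l1 Bl] := Bj; exists l => //.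
exact: subset_trans Bl _.
Qed.

(* A mixture [(1 - s) Q1 + s Q2] of two 0-1 probabilities does it: [s] is the
   infimum of the bounds [hi i] on [A], [Q1] vanishes on [K i] whenever
   [hi i < 1], and [Q2] sits on [A] outside every [K i] not almost containing
   [A]. *)
Lemma between_dominating (R : realType) (T I : Type) (K : I -> set T)
    (lo hi : I -> R) (i0 i1 : I) (A B : set T) (P : set T -> R) :
  set_chain K ->
  (forall i j, K i `<=` K j -> lo i <= lo j) ->
  (forall i, 0 <= hi i <= 1) -> (forall i, lo i <= hi i) ->
  K i0 = set0 -> hi i0 = 0 -> K i1 = setT -> lo i1 = 1 ->
  zero_one_valued lo ->
  almost_contains K lo A `<=` almost_contains K lo B ->
  between K lo hi P ->
  exists2 Q, between K lo hi Q & P (A `|` B) <= Q A.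
Proof.
move=> Kc lom hi01 lohi K0 hi0 K1 lo1 lo01 AB PK.
set S := almost_contains K lo A.
pose s := inf [set hi i | i in S].
have Si1 : S i1 by exists i1 => //; rewrite K1.
have hiS0 : has_lbound [set hi i | i in S].
  by exists 0 => _ [i _ <-]; case/andP: (hi01 i).
have sle i : S i -> s <= hi i by move=> Si; apply: ge_inf => //; exists i.
have s01 : 0 <= s <= 1.
  rewrite (le_trans (sle _ Si1)) ?andbT; last by case/andP: (hi01 i1).
  by apply: lb_le_inf => [|_ [i _ <-]]; [exists (hi i1), i1|case/andP: (hi01 i)].
have Ps : P (A `|` B) <= s.
  apply: lb_le_inf => [|_ [i Si <-]]; first by exists (hi i1), i1.
  by apply: almost_contains_le PK Si (AB _ Si).
have [Si0|nSi0] := pselect (S i0).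
  exists P => //; have [[P0 _ _] _] := PK.
  by apply: le_trans (P0 A); rewrite (le_trans Ps) // -hi0 sle.
have [||i j /= hi1 lj|G1 [G1U _ G1D G1C]] := @ultrafilter_cut T _ K
  [set i | hi i < 1] [set j | lo j = 1] setT Kc.
- by exists i0; rewrite /= hi0.
- by exists i1.
- by rewrite setTI => /lom; rewrite lj leNgt (le_lt_trans (lohi i)).
have [||i j /= nSi lj Aij|G2 [G2U G2A G2D G2C]] := @ultrafilter_cut T _ K
  (~` S) [set j | lo j = 1] A Kc.
- by exists i0.
- by exists i1.
- by apply: nSi; exists j.
exists (fun X => (1 - s) * ultra_prob R G1 X + s * ultra_prob R G2 X); last first.
  rewrite (ultra_probT _ G2A) mulr1 (le_trans Ps) // lerDr mulr_ge0 ?ler0n //.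
  by case/andP: s01 => _; rewrite subr_ge0.
have fQ := fap_conv s01 (fap_ultra_prob R G1U) (fap_ultra_prob R G2U).
split=> // i; apply/andP; split.
  have [->|li] := lo01 i; first by have [-> _ _] := fQ.
  by rewrite (ultra_probT _ (G1D i li)) (ultra_probT _ (G2D i li)) li; lra.
(* When [hi i < 1], only the second term charges [K i]: by at most [s <= hi i] if [S i], and by 0
   otherwise. *)
have [hi1|hi1] := ltP (hi i) 1; last by apply: le_trans hi1; exact: fap_le1 fQ.
rewrite (ultra_probF _ (G1C i hi1)) mulr0 add0r.
have [Si|nSi] := pselect (S i); last first.
  by rewrite (ultra_probF _ (G2C i nSi)) mulr0; case/andP: (hi01 i).
apply: le_trans (sle _ Si); rewrite ler_piMr //; first by case/andP: s01.
exact: fap_le1 (fap_ultra_prob R G2U).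
Qed.

Lemma between_max (R : realType) (T I : Type) (K : I -> set T)
    (lo hi : I -> R) (i0 i1 : I) :
  set_chain K ->
  (forall i j, K i `<=` K j -> lo i <= lo j) ->
  (forall i, 0 <= hi i <= 1) -> (forall i, lo i <= hi i) ->
  K i0 = set0 -> hi i0 = 0 -> K i1 = setT -> lo i1 = 1 ->
  zero_one_valued lo -> between K lo hi !=set0 ->
  maximum_preserving (fun A => sup [set P A | P in between K lo hi]).
Proof.
move=> Kc lom hi01 lohi K0 hi0 K1 lo1 lo01 [P0 P0K] A B.
have ub X : has_ubound [set P X | P in between K lo hi].
  by exists 1 => _ [P [fP _] <-]; exact: fap_le1.
have mono X Y : X `<=` Y ->
    sup [set P X | P in between K lo hi] <= sup [set P Y | P in between K lo hi].
  move=> XY; apply: ge_sup => [|_ [P PK <-]]; first by exists (P0 X), P0.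
  apply: (@le_trans _ _ (P Y)); first by apply: fap_le => //; case: PK.
  by apply: ub_le_sup => //; exists P.
have dom X Y : almost_contains K lo X `<=` almost_contains K lo Y ->
    sup [set P (X `|` Y) | P in between K lo hi] <=
    sup [set P X | P in between K lo hi].
  move=> XY; apply: ge_sup => [|_ [P PK <-]]; first by exists (P0 (X `|` Y)), P0.
  have [Q QK PQ] := between_dominating Kc lom hi01 lohi K0 hi0 K1 lo1 lo01 XY PK.
  by apply: le_trans PQ _; apply: ub_le_sup => //; exists Q.
apply/eqP; rewrite eq_le ge_max le_max.
rewrite (mono _ _ (@subsetUl _ A B)) (mono _ _ (@subsetUr _ A B)) !andbT.
apply/orP.
(* The set with fewer admissible indices has the larger infimum, so it dominates the union. *)
case: (almost_contains_total lo A B Kc) => AB; [left|right]; first exact: dom.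
by rewrite setUC; exact: dom.
Qed.

(** * Sufficiency for p-boxes *)

Lemma credal_set_between (R : realType) (d : Order.disp_t) (T : tbPreorderType d)
    (Fl Fu : T -> R) :
  credal_set Fl Fu = between (@lower_set d T) (oapp Fl 0) (oapp Fu 0).
Proof.
apply/seteqP; split=> P [fP PF]; split=> //; last by move=> x; exact: PF (Some x).
by move=> [x|] /=; [exact: PF|rewrite fap_set0 // lexx].
Qed.

(** Complementation exchanges the two bounds, so a 0-1-valued [hi] becomes a 0-1-valued lower
    bound. *)
Lemma betweenC (R : realType) (T I : Type) (K : I -> set T) (lo hi : I -> R) :
  between (fun i => ~` K i) (fun i => 1 - hi i) (fun i => 1 - lo i) =
  between K lo hi.
Proof.
apply/seteqP; split=> P [fP PK]; split=> // i; have /andP[] := PK i;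
  by rewrite fap_setC // => ? ?; apply/andP; split; lra.
Qed.

Lemma zero_one_natural_extension_max (R : realType) (d : Order.disp_t)
    (T : tbPreorderType d) (Fl Fu : T -> R) :
  total (fun x y : T => (x <= y)%O) -> is_pbox Fl Fu ->
  zero_one_valued Fl \/ zero_one_valued Fu ->
  maximum_preserving (natural_extension Fl Fu).
Proof.
move=> tot [cl cu lu] F01.
have ol i : 0 <= oapp Fl 0 i <= 1.
  by case: i => [x|] /=; [case: cl|rewrite lexx ler01].
have ou i : 0 <= oapp Fu 0 i <= 1.
  by case: i => [x|] /=; [case: cu|rewrite lexx ler01].
have olu i : oapp Fl 0 i <= oapp Fu 0 i by case: i => [x|] /=.
have lowT : lower_set (Some \top%O) = [set: T].
  by apply/seteqP; split=> x //= _; exact: lex1.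
have [_ _ l1] := cl; have [_ _ u1] := cu.
have Kc := lower_set_chain tot.
have ne : between (@lower_set d T) (oapp Fl 0) (oapp Fu 0) !=set0.
  have [P fP PF] := cdf_extension tot cl; exists P.
  by rewrite -credal_set_between; split=> // x; rewrite PF lexx lu.
have ext A : natural_extension Fl Fu A =
    sup [set P A | P in between (@lower_set d T) (oapp Fl 0) (oapp Fu 0)].
  by rewrite /natural_extension credal_set_between.
move=> A B; rewrite !ext; move: A B.
case: F01 => F01.
- apply: (@between_max _ _ _ _ _ _ None (Some \top%O)) => //.
    by move=> i j; exact: cdf_lower_set_le.
  by move=> [x|] /=; [exact: F01|left].
- rewrite -betweenC in ne *.
  (* After complementation the empty set sits at [Some \top] and the whole space at [None]. *)
  apply: (@between_max _ _ _ _ _ _ (Some \top%O) None) => //.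
  + exact: set_chainC.
  + by move=> i j /subsetC; rewrite !setCK => /(cdf_lower_set_le cu) ?; lra.
  + by move=> i; have /andP[? ?] := ol i; apply/andP; split; lra.
  + by move=> i; have := olu i; lra.
  + by rewrite lowT setCT.
  + by rewrite /= l1 subrr.
  + by rewrite setC0.
  + by rewrite /= subr0.
  + by move=> [x|] /=; [case: (F01 x) => ->; [right|left]; lra|right; lra].
Qed.

(** * Necessity: failure of maxitivity *)

(* The witness is a probability with cdf [min (Fu, max (Fl, Fu y))], which
   makes [P (down_set y)] as large as possible and, given that,
   [P (down_set x)] as small as possible. *)
Lemma natural_extension_not_max (R : realType) (d : Order.disp_t)
    (T : tbPreorderType d) (Fl Fu : T -> R) (x y : T) :
  total (fun x y : T => (x <= y)%O) -> is_pbox Fl Fu ->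
  0 < Fl x < 1 -> 0 < Fu y < 1 ->
  Num.max (natural_extension Fl Fu (down_set y))
          (natural_extension Fl Fu (~` down_set x)) <
  natural_extension Fl Fu (down_set y `|` ~` down_set x).
Proof.
move=> tot [[Flh Fl01 Fl1] [Fuh Fu01 Fu1] lu] /andP[x0 x1] /andP[y0 y1].
pose F z := Num.min (Fu z) (Num.max (Fl z) (Fu y)).
have cF : is_cdf F.
  split=> [z w zw|z|].
  - have Flzw := Flh _ _ zw; have Fuzw := Fuh _ _ zw.
    rewrite /F; case: (leP (Fl z) (Fu y)) => ?; case: (leP (Fl w) (Fu y)) => ?;
      case: (leP (Fu z)) => ?; case: (leP (Fu w)) => ?; lra.
  - have /andP[? ?] := Fu01 z; have /andP[? ?] := Fl01 z.
    by rewrite /F; case: (leP (Fl z) (Fu y)) => ?; case: (leP (Fu z)) => ?; lra.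
  - by rewrite /F Fl1 Fu1 (max_idPl (ltW y1)) minxx.
have [P fP PF] := cdf_extension tot cF.
have PK : credal_set Fl Fu P.
  split=> // z; rewrite PF /F ge_min lexx andbT le_min lu le_max lexx //.
have ub X : has_ubound [set P X | P in credal_set Fl Fu].
  by exists 1 => _ [Q [fQ _] <-]; exact: fap_le1.
have Ey : natural_extension Fl Fu (down_set y) <= Fu y.
  apply: ge_sup => [|_ [Q [_ QF] <-]]; first by exists (P (down_set y)), P.
  by case/andP: (QF y).
have Ex : natural_extension Fl Fu (~` down_set x) <= 1 - Fl x.
  apply: ge_sup => [|_ [Q [fQ QF] <-]]; first by exists (P (~` down_set x)), P.
  by rewrite fap_setC // lerD2l lerN2; case/andP: (QF x).
have : P (down_set y `|` ~` down_set x) <=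
    natural_extension Fl Fu (down_set y `|` ~` down_set x).
  by apply: ub_le_sup => //; exists P.
apply: lt_le_trans.
suff : Num.max (Fu y) (1 - Fl x) < P (down_set y `|` ~` down_set x).
  by rewrite !gt_max => /andP[yP xP]; rewrite (le_lt_trans Ey) ?(le_lt_trans Ex).
(* If [x <= y], the two sets cover the space, so [P] gives 1, which exceeds both [Fu y] and
   [1 - Fl x]. *)
have [xy|nxy] := boolP (x <= y)%O.
  rewrite (_ : _ `|` _ = setT).
    by have [_ -> _] := fP; rewrite gt_max y1 ltrBlDr ltrDl.
  rewrite -subTset => z _; have [zx|] := pselect (down_set x z); last by right.
  by left; exact: le_trans zx xy.
(* Otherwise the sets are disjoint and [F x = max (Fl x, Fu y)], so the union has probability
   [Fu y + 1 - F x]: either 1, or [Fu y + (1 - Fl x)] with both summands positive. *)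
have yx : (y <= x)%O by case/orP: (tot x y) nxy => [->|].
have [_ _ ->] := fP; last first.
  rewrite -subset0 => z [zy]; apply; exact: le_trans zy yx.
rewrite fap_setC // !PF /F.
have := Fuh _ _ yx; have := lu x; have := lu y => ? ? ?.
rewrite (max_idPr (lu y)) minxx gt_max.
by case: (leP (Fl x) (Fu y)) => ?; rewrite ?(min_idPr _) //; apply/andP; split; lra.
Qed.

Theorem corollary13 (R : realType) (d : Order.disp_t) (T : tbPreorderType d)
    (le_total : total (fun x y : T => (x <= y)%O))
    (Fl Fu : T -> R) (pbox : is_pbox Fl Fu) :
  maximum_preserving (natural_extension Fl Fu)
  <-> (zero_one_valued Fl \/ zero_one_valued Fu).
Proof.
split; last exact: zero_one_natural_extension_max.
move=> max_pres; have [[_ Fl01 _] [_ Fu01 _] _] := pbox.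
have strict (a : R) : 0 <= a <= 1 -> ~ (a = 0 \/ a = 1) -> 0 < a < 1.
  move=> /andP[a0 a1] /not_orP[/eqP n0 /eqP n1].
  by rewrite !lt_neqAle a0 a1 n1 eq_sym n0.
apply: contrapT => /not_orP[/existsNP[x nx] /existsNP[y ny]].
have := natural_extension_not_max le_total pbox
  (strict _ (Fl01 x) nx) (strict _ (Fu01 y) ny).
by rewrite max_pres ltxx.
Qed.
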